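(* Let $X$ be a random variable with law $\mathbb{P}_X$ in a separable Hilbert space $H$, let $\sigma>0$ and $k\ge1$. For any $c\in H^k$, consider the updated centers $c'\in H^k$ defined by $$c'_j=Q^*_{X\mid \ell_c(X)=j}(X)=\frac{\mathbb{P}_{X\mid\ell_c(X)=j}\Bigl[X\exp\Bigl(-\frac1{2\sigma^2}\lVert X-c_j\rVert^2\Bigr)\Bigr]}{\mathbb{P}_{X\mid\ell_c(X)=j}\Bigl[\exp\Bigl(-\frac1{2\sigma^2}\lVert X-c_j\rVert^2\Bigr)\Bigr]},\qquad 1\le j\le k .$$ Then $$\mathcal{C}_2(c')\le\mathcal{C}_2(c)-Q^*_X\bigl(\lVert c_{\ell_c(X)}-c'_{\ell_c(X)}\rVert^2\bigr)\le\mathcal{C}_2(c),$$ and accordingly $\mathcal{R}_2(c')\le\mathcal{R}_2(c)$.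
   Context: For a probability measure $P$, $P(f(X))$ denotes the expectation of $f(X)$ when $X\sim P$. For $c=(c_1,\dots,c_k)\in H^k$: - $\ell_c(x)=\min\bigl\{\arg\min_{1\le j\le k}\lVert x-c_j\rVert\bigr\}$ (smallest index of a closest center). - $\mathcal{C}_2(c)=\inf_{Q_X\in\mathcal{M}_+^1(H)}\Bigl\{2\sigma^2\,\mathcal{K}(Q_X,\mathbb{P}_X)+Q_X\bigl(\lVert X-c_{\ell_c(X)}\rVert^2\bigr)\Bigr\}=-2\sigma^2\log\mathbb{P}_X\Bigl\{\exp\Bigl[-\frac1{2\sigma^2}\min_{1\le j\le k}\lVert X-c_j\rVert^2\Bigr]\Bigr\}$, where $\mathcal{M}_+^1(H)$ is the set of probability measures on $H$ and $\mathcal{K}$ is the Kullback divergence, $\mathcal{K}(Q,P)=Q[\log(dQ/dP)]$ if $Q\ll P$ and $+\infty$ otherwise. - $\mathcal{R}_2(c)=2\sigma^2\,\mathbb{P}_X\Bigl[1-\exp\Bigl(-\frac1{2\sigma^2}\min_{1\le j\le k}\lVert X-c_j\rVert^2\Bigr)\Bigr]$ (the robust $k$-means criterion). - $Q^*_X$ (depending on $c$) is the probability measure with density $\frac{dQ^*_X}{d\mathbb{P}_X}=Z^{-1}\exp\bigl(-\frac1{2\sigma^2}\lVert X-c_{\ell_c(X)}\rVert^2\bigr)$, $Z$ being the normalizing constant. For indices $j$ with $\mathbb{P}_X(\ell_c(X)=j)=0$, $c'_j$ is given an arbitrary value. *)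

(* Defs.v *)
From HB Require Import structures.
From mathcomp Require Import all_boot all_order all_algebra sesquilinear.
From mathcomp Require Import all_classical all_reals all_analysis.
From mathcomp Require Import measurable_realfun.

Set Implicit Arguments.
Unset Strict Implicit.
Unset Printing Implicit Defensive.

Import Order.TTheory GRing.Theory Num.Theory.
Import numFieldTopology.Exports numFieldNormedType.Exports.

Local Open Scope classical_set_scope.
Local Open Scope ring_scope.

Notation borel T := (g_sigma_algebraType (@open T)).

Definition separable (T : topologicalType) : Prop :=
  exists D : set T, countable D /\ dense D.

Section bochner.
Context d (T : measurableType d) (R : realType) (H : completeNormedModType R).
Implicit Types (mu : {measure set T -> \bar R}) (f s : T -> H) (v : H).

Definition simple_vector_fun s : Prop :=
  measurable_fun [set: T] (s : T -> borel H) /\ finite_set (range s).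

(* [fine] sends an infinite mass to 0; for an s that is integrable this can
   only happen on the fibre of v = 0. *)
Definition simple_integral mu s : H :=
  \sum_(v \in range s) fine (mu (s @^-1` [set v])) *: v.

(* On a separable space Borel measurability is strong measurability. *)
Definition is_bochner_integral mu f v : Prop :=
  measurable_fun [set: T] (f : T -> borel H) /\
  exists s : nat -> T -> H,
    [/\ forall n, simple_vector_fun (s n),
        (\int[mu]_x (`|f x - s n x|)%:E)%E @[n --> \oo] --> 0%E &
        simple_integral mu (s n) @[n --> \oo] --> v].

(* Arbitrary when f is not Bochner integrable. *)
Definition bochner_integral mu f : H := get (is_bochner_integral mu f).

End bochner.

Section kullback.
Context d (T : measurableType d) (R : realType).

Definition kullback (Q P : probability T R) : \bar R :=
  if `[< Q `<< P >]
  then (\int[Q]_x lne (Radon_Nikodym (charge_of_finite_measure Q) P x))%E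
  else +oo%E.

(* The conditional law given a measurable D with P D <> 0; [mnormalize] asks
   for a default law when P D = 0, for which P itself is taken. *)
Definition conditional (P : probability T R) (D : set T) (mD : measurable D) :
    probability T R :=
  mnormalize (mrestr P mD) P.

End kullback.

Section centers.
Context (R : realType) (H : completeNormedModType R) (k : nat).
Implicit Types (c : 'I_k.+1 -> H) (x : H) (j : 'I_k.+1).

Definition is_closest c x j : bool := [forall i, `|x - c j| <= `|x - c i|].

(* The outer arg min is the least index for the order on nat. *)
Definition label c x : 'I_k.+1 :=
  [arg min_(j < [arg min_(i < ord0) `|x - c i|%R]%O | is_closest c x j) j]%N.

Definition cell c j : set (borel H) := [set x | label c x = j].

Definition min_sqdist c x : R :=
  \big[Order.min/`|x - c ord0| ^+ 2]_(j < k.+1) `|x - c j| ^+ 2.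

Lemma is_closest_label c x : is_closest c x (label c x).
Proof.
rewrite /label; case: arg_minnP => //.
case: arg_minP => // j _ jmin.
by apply/forallP => i; exact: jmin.
Qed.

Lemma label_min c x j : is_closest c x j -> (label c x <= j)%N.
Proof.
rewrite /label; case: arg_minnP => [|i _ imin]; last exact: imin.
case: arg_minP => // i _ imin.
by apply/forallP => l; exact: imin.
Qed.

Lemma cellE c j : cell c j =
  [set x | is_closest c x j] `&`
  \bigcap_(i in [set i : 'I_k.+1 | (i < j)%N]) ~` [set x | is_closest c x i].
Proof.
apply/seteqP; split=> x /=.
  move=> xj; split; first by rewrite -xj; exact: is_closest_label.
  by move=> i /= ij /label_min; rewrite /cell/= xj leqNgt ij.
move=> [xj jmin]; apply/val_inj/eqP; rewrite /= eqn_leq label_min//= leqNgt.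
by apply/negP => /jmin; apply; exact: is_closest_label.
Qed.

Lemma continuous_dist (a : H) : continuous (fun x : H => `|x - a|).
Proof.
by move=> x; apply: cvg_norm; apply: cvgB; [exact: cvg_id|exact: cvg_cst].
Qed.

Lemma measurable_closest c j :
  measurable ([set x | is_closest c x j] : set (borel H)).
Proof.
rewrite (_ : [set _ | _] = \bigcap_(i in [set: 'I_k.+1])
    ~` [set x : H | `|x - c i| - `|x - c j| < 0]); last first.
  apply/seteqP; split=> x /=.
    by move=> /forallP xj i _ /=; apply/negP; rewrite -leNgt subr_ge0.
  move=> xj; apply/forallP => i; have /negP := xj i Logic.I.
  by rewrite -leNgt subr_ge0.
apply: (@fin_bigcap_measurable _ (borel H)) => // i _.
apply: (@measurableC _ (borel H)); apply: sub_sigma_algebra.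
apply: (@open_comp _ _ (fun x : H => `|x - c i| - `|x - c j|) [set y | y < 0]).
  by move=> x _; apply: cvgB; exact: continuous_dist.
exact: open_lt.
Qed.

Lemma measurable_cell c j : measurable (cell c j).
Proof.
rewrite cellE; apply: measurableI; first exact: measurable_closest.
apply: fin_bigcap_measurable => // i _.
by apply: measurableC; exact: measurable_closest.
Qed.

Lemma measurable_label_dist c :
  measurable_fun [set: borel H] (fun x : borel H => `|(x : H) - c (label c x)|).
Proof.
have mdist j : measurable_fun [set: borel H]
      (fun x : borel H => `|(x : H) - c j|).
  apply: (measurability _ (RGenOpens.measurableE R)) => _ [_ [a [b ->] <-]].
  rewrite setTI; apply: sub_sigma_algebra.
  apply: (@open_comp _ _ (fun x : H => `|x - c j|)); last exact: interval_open.
  by move=> x _; exact: continuous_dist.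
rewrite (_ : (fun _ => _) = fun x : borel H =>
    \sum_(j <- enum 'I_k.+1) \1_(cell c j) x * `|(x : H) - c j|); last first.
  apply/funext => x; rewrite big_enum/= (bigD1 (label c x))//= big1 => [|j jx].
    by rewrite indicE mem_set// mul1r addr0.
  by rewrite indicE memNset ?mul0r//= => /esym/eqP; exact/negP.
apply: measurable_sum => j; apply: measurable_funM => //.
by apply: measurable_indic; exact: measurable_cell.
Qed.

End centers.

Section criteria.
Context (R : realType) (H : completeNormedModType R) (k : nat).
Variables (P : probability (borel H) R) (sigma : R).
Implicit Type c : 'I_k.+1 -> H.

Definition distortion c (x : H) : R := `|x - c (label c x)| ^+ 2.

Definition C2 c : \bar R :=
  ereal_inf [set ((2 * sigma ^+ 2)%:E * kullback Q P
                  + \int[Q]_x (distortion c x)%:E)%E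
            | Q in [set: probability (borel H) R]].

Definition R2 c : \bar R :=
  ((2 * sigma ^+ 2)%:E *
   \int[P]_x (1 - expR (- (2 * sigma ^+ 2)^-1 * min_sqdist c x))%:E)%E.

Definition gibbs_weight c (x : H) : R :=
  expR (- (2 * sigma ^+ 2)^-1 * distortion c x).

Definition gibbs_constant c : R := \int[P]_x gibbs_weight c x.

(* The law with density exp(- |x - c_l(x)|^2 / (2 sigma^2)) / Z against P. *)
Definition gibbs c (A : set (borel H)) : \bar R :=
  (\int[P]_(x in A) ((gibbs_constant c)^-1 * gibbs_weight c x)%:E)%E.

Lemma measurable_gibbs_weight c :
  measurable_fun [set: borel H] (gibbs_weight c : borel H -> R).
Proof.
apply: measurableT_comp => //; apply: measurable_funM => //.
by apply: measurable_funX; exact: measurable_label_dist.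
Qed.

Lemma gibbs_weight_le1 c x : gibbs_weight c x <= 1.
Proof.
rewrite -expR0 ler_expR mulNr oppr_le0 mulr_ge0// ?exprn_ge0//.
by rewrite invr_ge0 mulr_ge0// sqr_ge0.
Qed.

Lemma integrable_gibbs_weight c :
  P.-integrable [set: borel H] (fun x => (gibbs_weight c x)%:E).
Proof.
apply: (le_integrable measurableT _ _
  (finite_measure_integrable_cst P 1 measurableT)).
- by apply/measurable_EFinP; exact: measurable_gibbs_weight.
- move=> x _; rewrite /= lee_fin normr1 ger0_norm ?expR_ge0//.
  exact: gibbs_weight_le1.
Qed.

Lemma gibbs_constantE c :
  (gibbs_constant c)%:E = (\int[P]_x (gibbs_weight c x)%:E)%E.
Proof.
rewrite fineK//; apply: integrable_fin_num => //.
exact: integrable_gibbs_weight.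
Qed.

Lemma gibbs_constant_gt0 c : 0 < gibbs_constant c.
Proof.
rewrite -lte_fin gibbs_constantE lt0e; apply/andP; split; last first.
  by apply: integral_ge0 => x _; rewrite lee_fin expR_ge0.
apply/eqP => int0.
have mw : measurable_fun [set: borel H]
    (fun x : borel H => (gibbs_weight c x)%:E).
  by apply/measurable_EFinP; exact: measurable_gibbs_weight.
have [+ _] := ae_eq_integral_abs P measurableT mw.
under eq_integral do rewrite /= ger0_norm ?expR_ge0//.
move=> /(_ int0) [N [mN PN0 subN]].
have : P [set: borel H] = 0%E.
  rewrite -PN0; congr (P _); apply/seteqP; split=> x // _.
  apply: subN => /= /(_ Logic.I) [wx0].
  have : 0 < gibbs_weight c x by exact: expR_gt0.
  by rewrite wx0 ltxx.
by rewrite probability_setT => -[] /eqP; rewrite oner_eq0.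
Qed.

Let gibbs_density_ge0 c x :
  (0 <= ((gibbs_constant c)^-1 * gibbs_weight c x)%:E)%E.
Proof.
by rewrite lee_fin mulr_ge0 ?expR_ge0// invr_ge0 ltW// gibbs_constant_gt0.
Qed.

Let gibbs0 c : gibbs c set0 = 0%E.
Proof. exact: integral_set0. Qed.

Let gibbs_ge0 c A : (0 <= gibbs c A)%E.
Proof. by apply: integral_ge0 => x _; exact: gibbs_density_ge0. Qed.

Let gibbs_sigma_additive c : semi_sigma_additive (gibbs c).
Proof.
apply: semi_sigma_additive_nng_induced => [|x]; last exact: gibbs_density_ge0.
by apply/measurable_EFinP/measurable_funM => //; exact: measurable_gibbs_weight.
Qed.

HB.instance Definition _ c := isMeasure.Build _ _ _ (gibbs c)
  (gibbs0 c) (@gibbs_ge0 c) (@gibbs_sigma_additive c).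

Let gibbs_setT c : gibbs c [set: borel H] = 1%:E.
Proof.
rewrite /gibbs; under eq_integral do rewrite EFinM.
rewrite integralZl//; last exact: integrable_gibbs_weight.
by rewrite -gibbs_constantE -EFinM mulVf// gt_eqF// gibbs_constant_gt0.
Qed.

HB.instance Definition _ c := @Measure_isProbability.Build _ _ R
  (gibbs c) (gibbs_setT c).

Definition updated_center c (j : 'I_k.+1) : H :=
  bochner_integral (conditional (gibbs c) (measurable_cell c j)) id.

Definition weighted_center c (j : 'I_k.+1) : H :=
  let Pj := conditional P (measurable_cell c j) in
  let w (x : H) := expR (- (2 * sigma ^+ 2)^-1 * `|x - c j| ^+ 2) in
  (\int[Pj]_x w x)^-1 *:
    bochner_integral Pj (fun x : borel H => w x *: (x : H)).

End criteria.

(* Main.v *)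
Require Import Defs.
From HB Require Import structures.
From mathcomp Require Import all_boot all_order all_algebra sesquilinear.
From mathcomp Require Import all_classical all_reals all_analysis.
From mathcomp Require Import measurable_realfun lra.

Set Implicit Arguments.
Unset Strict Implicit.
Unset Printing Implicit Defensive.

Import Order.TTheory GRing.Theory Num.Theory.
Import numFieldTopology.Exports numFieldNormedType.Exports.

Local Open Scope classical_set_scope.
Local Open Scope ring_scope.

(** The update is one step of alternating minimization. Writing [d_c(x)] for
the squared distance from [x] to the center of its cell and [s = 2 sigma^2],
the criterion [C2 c] is the infimum over laws [Q] of the free energy
[s K(Q, P) + Q(d_c)]. By the Gibbs variational principle this infimum is
[- s ln Z_c] and it is attained at the Gibbs law [G], of density
[exp (- d_c / s) / Z_c] ([C2E]).

For the new centers, use the old Gibbs law [G] as a competitor in the infimum: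
[C2 c' <= s K(G, P) + G(d_c')], so that only the second term changes
([C2_le]). The old labelling is in general not the nearest-center labelling
of [c'], hence [d_c'(x) <= |x - c'_l|^2] with [l = label c x]. Finally each
[c'_j] is the mean of [G] conditioned on the cell [j], so that on each cell the
cross term in the expansion of [|(x - c'_l) + (c'_l - c_l)|^2] integrates to
zero, and [G(|x - c'_l|^2) = G(d_c) - G(|c_l - c'_l|^2)]
([distortion_updated_center]). The statement on [R2] follows because
[R2 c = s (1 - Z_c)] is, like [C2 c], a decreasing function of [Z_c].

Three ingredients are built first. The Gibbs principle is derived from the
bound [ln t <= t - 1] applied to the ratio of the two densities
([kullback_ge]). Integrals against the Gibbs law and against conditional laws
are brought back to [P] by a change of variables for laws with a density.
Vector means are handled through their inner products: the Bochner integral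
of a function with integrable norm exists because [H] is separable and
complete, and [dot (bochner_integral mu f) u] is the integral of [dot (f x) u]
([dot_bochner_integral]); the two formulas for the updated center are then
compared coordinate by coordinate. *)

(** * Laws with a density *)

Section density.
Context d (T : measurableType d) (R : realType).
Variables (nu mu : {finite_measure set T -> \bar R}) (phi : T -> R).
Hypothesis mphi : measurable_fun [set: T] phi.
Hypothesis phi_ge0 : forall x, 0 <= phi x.
Hypothesis nuE : forall A, measurable A ->
  nu A = (\int[mu]_(x in A) (phi x)%:E)%E.

Lemma density_dominates : nu `<< mu.
Proof.
apply/null_content_dominatesP => A mA muA0; rewrite nuE//.
apply: null_set_integral => //; apply/measurable_EFinP.
exact: measurable_funTS.
Qed.

Let ephi_int : mu.-integrable [set: T] (EFin \o phi).
Proof.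
apply/integrableP; split; first exact/measurable_EFinP.
under eq_integral do rewrite /= ger0_norm//.
by rewrite -nuE// ltey_eq fin_num_measure.
Qed.

Lemma density_ae_eq :
  ae_eq mu [set: T] (Radon_Nikodym_SigmaFinite.f nu mu) (EFin \o phi).
Proof.
apply: integral_ae_eq => //.
- exact/Radon_Nikodym_SigmaFinite.f_integrable/density_dominates.
- exact/measurable_EFinP.
- move=> A _ mA; rewrite -Radon_Nikodym_SigmaFinite.f_integral//.
    exact: nuE.
  exact: density_dominates.
Qed.

(** The Radon-Nikodym derivative of [nu] agrees with [phi] almost everywhere,
so that the change of variables for this derivative transfers to [phi]. *)
Lemma ge0_integral_density (f : T -> \bar R) :
  measurable_fun [set: T] f -> (forall x, (0 <= f x)%E) ->
  (\int[nu]_x f x = \int[mu]_x (f x * (phi x)%:E))%E.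
Proof.
move=> mf f0.
rewrite -(Radon_Nikodym_SigmaFinite.change_of_variables density_dominates)//.
apply: ae_eq_integral => //.
- apply: emeasurable_funM => //; apply: measurable_int.
  exact/Radon_Nikodym_SigmaFinite.f_integrable/density_dominates.
- by apply: emeasurable_funM => //; exact/measurable_EFinP.
- exact/ae_eqe_mul2l/density_ae_eq.
Qed.

Lemma integrable_density (f : T -> R) : measurable_fun [set: T] f ->
  mu.-integrable [set: T] (EFin \o (fun x => f x * phi x)) ->
  nu.-integrable [set: T] (EFin \o f).
Proof.
move=> mf /integrableP[_ fi]; apply/integrableP; split.
  exact/measurable_EFinP.
rewrite ge0_integral_density//; last first.
  by apply: measurableT_comp => //; exact/measurable_EFinP.
move: fi; apply: le_lt_trans; rewrite le_eqVlt; apply/orP; left; apply/eqP.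
by apply: eq_integral => x _; rewrite /= normrM [`|phi x|]ger0_norm.
Qed.

Lemma Rintegral_density (f : T -> R) : measurable_fun [set: T] f ->
  \int[nu]_x f x = \int[mu]_x (f x * phi x).
Proof.
move=> mf; have mEf : measurable_fun [set: T] (EFin \o f).
  exact/measurable_EFinP.
congr fine; rewrite integralE [RHS]integralE.
rewrite !ge0_integral_density//; last 2 first.
- exact: measurable_funeneg.
- exact: measurable_funepos.
congr (_ - _)%E; apply: eq_integral => x _; rewrite ?funeposE ?funenegE/=.
  by rewrite -!EFin_max -EFinM maxr_pMl// mul0r.
by rewrite -!EFin_max -EFinM maxr_pMl// mul0r mulNr.
Qed.

End density.

(** Only the two one-sided parts are compared, so either integral may be
infinite: the Kullback integrand need not be integrable. *)
Lemma le_ae_integral d (T : measurableType d) (R : realType)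
    (mu : {measure set T -> \bar R}) (f g : T -> \bar R) :
  measurable_fun [set: T] f -> measurable_fun [set: T] g ->
  {ae mu, forall x, (f x <= g x)%E} -> (\int[mu]_x f x <= \int[mu]_x g x)%E.
Proof.
move=> mf mg fg; rewrite integralE [leRHS]integralE; apply: leeB.
- apply: ae_ge0_le_integral => //.
  + exact: measurable_funepos.
  + exact: measurable_funepos.
  + apply: filterS fg => x fg _; rewrite !funeposE.
    by rewrite ge_max !le_max fg lexx !orbT.
- apply: ae_ge0_le_integral => //.
  + exact: measurable_funeneg.
  + exact: measurable_funeneg.
  + apply: filterS fg => x fg _; rewrite !funenegE.
    by rewrite ge_max !le_max leeN2 fg lexx !orbT.
Qed.

Lemma probability_integral_cst d (T : measurableType d) (R : realType)
    (P : probability T R) (r : R) : (\int[P]_x r%:E = r%:E)%E.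
Proof.
rewrite integral_cst// [X in (_ * X)%E](_ : _ = 1%E) ?mule1//.
exact: probability_setT.
Qed.

(** * The Kullback divergence *)

Section kullback_theory.
Context d (T : measurableType d) (R : realType).
Variables (Q P : probability T R).
Implicit Type psi : T -> R.

Let RN := Radon_Nikodym (charge_of_finite_measure Q) P.

Let measurable_lne_RN :
  Q `<< P -> measurable_fun [set: T] (fun x => lne (RN x)).
Proof.
move=> QP.
rewrite (_ : (fun _ => _) = fun x => if fine (RN x) <= 0 then -oo%E
                               else (ln (fine (RN x)))%:E); last first.
  apply/funext => x /=.
  have RNfin : RN x \is a fin_num.
    exact: (@Radon_Nikodym_fin_num _ _ _ (charge_of_finite_measure Q) P).
  by rewrite -[in LHS](fineK RNfin).
have mRN : measurable_fun [set: T] (fine \o RN).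
  apply: measurableT_comp => //; apply: measurable_int.
  exact: (@Radon_Nikodym_integrable _ _ _ (charge_of_finite_measure Q) P QP).
apply: measurable_fun_ifT => //.
  exact: measurable_fun_ler.
by apply/measurable_EFinP; apply: measurableT_comp.
Qed.

Lemma kullback_density psi : measurable_fun [set: T] psi ->
    (forall x, 0 < psi x) ->
    (forall A, measurable A -> Q A = (\int[P]_(x in A) (psi x)%:E)%E) ->
  (kullback Q P = \int[Q]_x (ln (psi x))%:E)%E.
Proof.
move=> mpsi psi0 QE.
have QP : Q `<< P := density_dominates mpsi QE.
rewrite /kullback asboolT//; apply: ae_eq_integral => //.
- exact: measurable_lne_RN.
- by apply/measurable_EFinP; exact: measurableT_comp.
have := ae_eq_trans (ae_eq_sym (ae_eq_Radon_Nikodym_SigmaFinite QP measurableT))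
  (density_ae_eq mpsi QE).
move=> /(null_dominates_ae_eq measurableT QP).
by apply: filterS => x /= /[apply] ->; rewrite lne_EFin.
Qed.

(** Donsker-Varadhan inequality. With [f = dQ/dP] and [r = psi / f], the bound
[ln r <= r - 1] gives [ln psi + 1 - r <= ln f], and [r] has [Q]-mass at most
[P(psi) <= 1]. *)
Lemma kullback_ge psi : measurable_fun [set: T] psi ->
    (forall x, 0 < psi x) -> (\int[P]_x (psi x)%:E <= 1)%E ->
    Q.-integrable [set: T] (fun x => (ln (psi x))%:E) ->
  (\int[Q]_x (ln (psi x))%:E <= kullback Q P)%E.
Proof.
move=> mpsi psi0 Ppsi ipsi; rewrite /kullback.
case: asboolP => [QP|_]; last by rewrite leey.
pose f := Radon_Nikodym_SigmaFinite.f Q P.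
have f0 x : (0 <= f x)%E by exact: Radon_Nikodym_SigmaFinite.f_ge0.
have ffin x : f x \is a fin_num by exact: Radon_Nikodym_SigmaFinite.f_fin_num.
have intf := Radon_Nikodym_SigmaFinite.f_integrable QP.
have mf : measurable_fun [set: T] (fine \o f).
  by apply: measurableT_comp => //; exact: measurable_int intf.
(* The exponential stands for the inverse of f, as its measurability comes
   for free; it is 1 where f vanishes, which is harmless as r f = 0 there. *)
pose r x := psi x * expR (- ln (fine (f x))).
have rE x : 0 < fine (f x) -> r x = psi x / fine (f x).
  by move=> fx0; rewrite /r -lnV ?posrE// lnK// posrE invr_gt0.
have r0 x : 0 <= r x by rewrite mulr_ge0 ?expR_ge0// ltW.
have mr : measurable_fun [set: T] r.
  apply: measurable_funM => //; apply: measurableT_comp => //.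
  by apply: measurableT_comp => //; exact: measurableT_comp.
have Qr : (\int[Q]_x (r x)%:E <= 1)%E.
  rewrite -(Radon_Nikodym_SigmaFinite.change_of_variables QP)//; last first.
    exact/measurable_EFinP.
  apply: le_trans Ppsi; apply: ge0_le_integral => //=.
  - by move=> x _; rewrite mule_ge0 ?lee_fin.
  - apply: emeasurable_funM; first exact/measurable_EFinP.
    exact: measurable_int intf.
  - exact/measurable_EFinP.
  - move=> x _; rewrite -/f -(fineK (ffin x)) -EFinM lee_fin.
    have [->|fx0] := eqVneq (fine (f x)) 0; first by rewrite mulr0 ltW.
    by rewrite rE ?divfK// lt0r fx0 fine_ge0.
have ir : Q.-integrable [set: T] (EFin \o r).
  apply/integrableP; split; first exact/measurable_EFinP.
  under eq_integral do rewrite /= ger0_norm//.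
  by rewrite (le_lt_trans Qr)// ltry.
have i1 := finite_measure_integrable_cst Q 1 measurableT.
apply: (@le_trans _ _ (\int[Q]_x ((ln (psi x) + (1 - r x))%:E))%E).
  under [leRHS]eq_integral do rewrite EFinD.
  rewrite integralD//; last first.
    by under eq_fun do rewrite EFinB; exact: integrableB.
  rewrite leeDl//; under eq_integral do rewrite EFinB.
  rewrite integralB//= probability_integral_cst.
  by rewrite sube_ge0// integrable_fin_num.
have mlnpsi : measurable_fun [set: T] (fun x => ln (psi x)).
  exact: measurableT_comp.
apply: le_ae_integral.
- apply/measurable_EFinP; apply: measurable_funD => //.
  exact: measurable_funB.
- exact: measurable_lne_RN.
have mf0 : measurable [set x | fine (f x) = 0].
  by rewrite -[X in measurable X]setTI; exact: (mf measurableT [set 0]).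
have Qf0 : Q [set x | fine (f x) = 0] = 0%E.
  rewrite (Radon_Nikodym_SigmaFinite.f_integral QP)// -/f.
  apply: integral0_eq => x /= fx0.
  by rewrite -(fineK (ffin x)) fx0.
have fpos : {ae Q, forall x, 0 < fine (f x)}.
  exists [set x | fine (f x) = 0]; split => //.
  move=> x /= /negP; rewrite -leNgt => fx0.
  by apply/eqP; rewrite eq_le fx0 fine_ge0.
have := null_dominates_ae_eq measurableT QP
  (ae_eq_Radon_Nikodym_SigmaFinite QP measurableT).
apply: filterS2 fpos => x fx0 /(_ Logic.I) <-.
rewrite -/f -(fineK (ffin x)) lne_EFin// lee_fin.
have rx0 : 0 < r x by rewrite rE// divr_gt0.
have := @le_ln1Dx _ (r x - 1).
rewrite ltrBrDl subrr => /(_ rx0); rewrite addrC subrK rE//.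
by rewrite ln_div ?posrE//; lra.
Qed.

End kullback_theory.

(** * Inner product and Borel measurability *)

Section inner_product.
Context (R : realType) (H : completeNormedModType R) (dot : {dot H for idfun}).
Hypothesis norm_dot : forall x : H, `|x| ^+ 2 = dot x x.
Implicit Types x y u : H.

Lemma dotC x y : dot x y = dot y x.
Proof. by rewrite hermC expr0 mul1r. Qed.

Lemma sqr_normD x u : `|x + u| ^+ 2 = `|x| ^+ 2 + 2 * dot x u + `|u| ^+ 2.
Proof. by rewrite !norm_dot linearDl !linearDr/= (dotC u x); lra. Qed.

(** Cauchy-Schwarz: expanding the square of the triangle inequality
[|x + u| <= |x| + |u|] leaves exactly this bound. *)
Lemma dot_le x u : `|dot x u| <= `|x| * `|u|.
Proof.
have le1 y : dot y u <= `|y| * `|u|.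
  have := lerXn2r 2 (normr_ge0 _) (addr_ge0 (normr_ge0 y) (normr_ge0 u))
    (ler_normD y u).
  by rewrite sqr_normD sqrrD -[_ *+ 2]mulr_natl; lra.
rewrite ler_norml le1 andbT lerNl -linearNl.
by rewrite (le_trans (le1 _))// normrN.
Qed.

Lemma dot_inj x y : (forall u, dot x u = dot y u) -> x = y.
Proof.
move=> xy; apply/eqP; rewrite -subr_eq0 -normr_eq0 -sqrf_eq0 norm_dot.
by rewrite linearBl/= xy subrr.
Qed.

(** By polarization the inner product inherits the continuity of the norm. *)
Lemma continuous_dot u : continuous (fun x => dot x u).
Proof.
rewrite (_ : (fun _ => _) =
    fun x => 2^-1 * (`|x + u| ^+ 2 - `|x| ^+ 2 - `|u| ^+ 2)); last first.
  by apply/funext => x; rewrite sqr_normD; lra.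
have sqr_cont (f : H -> R) : continuous f -> continuous (fun x => f x ^+ 2).
  by move=> cf x; exact: (continuous_comp (cf x) (@exprn_continuous _ 2 _)).
move=> x; apply: cvgM; first exact: cvg_cst.
apply: cvgB; last exact: cvg_cst.
apply: cvgB; last by apply: sqr_cont; exact: norm_continuous.
apply: (sqr_cont (fun x : H => `|x + u|)) => y.
by apply: cvg_norm; apply: cvgD; [exact: cvg_id|exact: cvg_cst].
Qed.

End inner_product.

Section borel_measurability.
Context (R : realType) (H : completeNormedModType R).

Lemma continuous_borel_fun (f : H -> H) : continuous f ->
  measurable_fun [set: borel H] (f : borel H -> borel H).
Proof.
move=> cf; apply: (@measurability _ _ (borel H) (borel H) _ _ (@open H)) => //.
move=> _ [A oA <-]; rewrite setTI; apply: sub_sigma_algebra.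
by apply: open_comp => // x _; exact: cf.
Qed.

Lemma continuous_borel_realfun (f : H -> R) : continuous f ->
  measurable_fun [set: borel H] (f : borel H -> R).
Proof.
move=> cf; apply: (measurability _ (RGenOpens.measurableE R)).
move=> _ [_ [a [b ->] <-]]; rewrite setTI; apply: sub_sigma_algebra.
apply: open_comp; last exact: interval_open.
by move=> x _; exact: cf.
Qed.

Lemma measurable_borel_set1 (v : H) : measurable ([set v] : set (borel H)).
Proof.
rewrite -[X in measurable X]setCK.
apply: (@measurableC _ (borel H)); apply: sub_sigma_algebra.
apply: closed_openC; apply: accessible_closed_set1.
exact/hausdorff_accessible/norm_hausdorff.
Qed.

End borel_measurability.

(** * The Bochner integral, tested against vectors *)

Section bochner_theory.
Context d (T : measurableType d) (R : realType) (H : completeNormedModType R).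
Context (dot : {dot H for idfun}).
Hypothesis norm_dot : forall x : H, `|x| ^+ 2 = dot x x.
Variable mu : {finite_measure set T -> \bar R}.
Implicit Types (f s : T -> H) (u v : H).

Lemma measurable_fun_dot f u : measurable_fun [set: T] (f : T -> borel H) ->
  measurable_fun [set: T] (fun x => dot (f x) u).
Proof.
apply: (@measurableT_comp _ _ _ _ (borel H) _ (fun y : H => dot y u)).
by apply: continuous_borel_realfun; exact: (continuous_dot norm_dot).
Qed.

Lemma measurable_fun_dist f v : measurable_fun [set: T] (f : T -> borel H) ->
  measurable_fun [set: T] (fun x => `|f x - v|).
Proof.
apply: (@measurableT_comp _ _ _ _ (borel H) _ (fun y : H => `|y - v|)).
by apply: continuous_borel_realfun; exact: continuous_dist.
Qed.

(** Every function of [s x] is a finite sum over the fibres of [s]; this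
reduces its measurability and its integral to those of indicators. *)
Lemma simple_fun_sum s (h : T -> H -> R) x : simple_vector_fun s ->
  h x (s x) = \sum_(v <- finmap.enum_fset (fset_set (range s)))
                h x v * \1_(s @^-1` [set v]) x.
Proof.
move=> [_ fs].
rewrite (bigD1_seq (s x))/=; last 2 first.
- by rewrite in_fset_set// inE; exists x.
- exact: finmap.fset_uniq.
rewrite indicE mem_set// mulr1 big1 ?addr0// => v vs.
by rewrite indicE memNset ?mulr0//= => /esym/eqP; exact/negP.
Qed.

Lemma measurable_simple_fiber s v : simple_vector_fun s ->
  measurable (s @^-1` [set v]).
Proof.
by move=> [ms _]; rewrite -[X in measurable X]setTI;
  exact: (ms measurableT _ (measurable_borel_set1 v)).
Qed.

Lemma measurable_fun_dist_simple f s :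
    measurable_fun [set: T] (f : T -> borel H) -> simple_vector_fun s ->
  measurable_fun [set: T] (fun x => `|f x - s x|).
Proof.
move=> mf ss; rewrite (_ : (fun _ => _) = fun x =>
  \sum_(v <- finmap.enum_fset (fset_set (range s)))
     `|f x - v| * \1_(s @^-1` [set v]) x); last first.
  by apply/funext => x; rewrite (simple_fun_sum (fun x v => `|f x - v|) x ss).
apply: measurable_sum => v; apply: measurable_funM.
  exact: measurable_fun_dist.
by apply: measurable_indic; exact: measurable_simple_fiber.
Qed.

Let integrable_dot_indic s u v : simple_vector_fun s ->
  mu.-integrable [set: T] (fun x => (dot v u * \1_(s @^-1` [set v]) x)%:E).
Proof.
move=> ss; under eq_fun do rewrite EFinM.
apply: integrableZl => //; apply: integrable_indic => //.
exact: measurable_simple_fiber.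
Qed.

Lemma integrable_dot_simple s u : simple_vector_fun s ->
  mu.-integrable [set: T] (fun x => (dot (s x) u)%:E).
Proof.
move=> ss.
under eq_fun do rewrite (simple_fun_sum (fun _ v => dot v u) _ ss) -sumEFin.
by apply: integrable_sum => // v _; exact: integrable_dot_indic.
Qed.

Lemma dot_simple_integral s u : simple_vector_fun s ->
  dot (simple_integral mu s) u = \int[mu]_x dot (s x) u.
Proof.
move=> ss; rewrite /simple_integral fsbig_finite; last by case: ss.
rewrite linear_sumlz/= /Rintegral.
under eq_integral do
  rewrite (simple_fun_sum (fun _ v => dot v u) _ ss) -sumEFin.
rewrite integral_sum//; last by move=> v; exact: integrable_dot_indic.
rewrite -sum_fine; last first.
  by move=> v _; apply: integrable_fin_num => //; exact: integrable_dot_indic.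
apply: eq_bigr => v _; rewrite linearZl_LR/=.
have mv := measurable_simple_fiber v ss.
under eq_integral do rewrite EFinM.
rewrite integralZl//; last exact: integrable_indic.
rewrite integral_indic// setIT fineM//= 1?mulrC//.
exact: fin_num_measure.
Qed.

Lemma integrable_dot f u : measurable_fun [set: T] (f : T -> borel H) ->
    mu.-integrable [set: T] (fun x => `|f x|%:E) ->
  mu.-integrable [set: T] (fun x => (dot (f x) u)%:E).
Proof.
move=> mf fi; have := integrableZl measurableT `|u| fi.
apply: le_integrable => //.
  by apply/measurable_EFinP; exact: measurable_fun_dot.
move=> x _; rewrite /= lee_fin mulrC [leRHS]ger0_norm ?mulr_ge0//.
exact: (dot_le norm_dot).
Qed.

(** The key estimate: it identifies any Bochner integral of [f] (as [s] tends
to [f]) and shows that the integrals of approximations are Cauchy. The right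
side may be infinite. *)
Lemma simple_integral_error f s u :
    measurable_fun [set: T] (f : T -> borel H) -> simple_vector_fun s ->
    mu.-integrable [set: T] (fun x => `|f x|%:E) ->
  (`| dot (simple_integral mu s) u - \int[mu]_x dot (f x) u |%:E
   <= `|u|%:E * \int[mu]_x `|f x - s x|%:E)%E.
Proof.
move=> mf ss fi; have fui := integrable_dot u mf fi.
have sui := integrable_dot_simple u ss.
have mfs := measurable_fun_dist_simple mf ss.
rewrite dot_simple_integral// -RintegralB// EFin_normr_Rintegral//; last first.
  exact: (integrableB measurableT sui fui).
apply: (le_trans (le_abse_integral _ _ _)) => //.
  apply/measurable_EFinP/measurable_funB; apply: measurable_fun_dot => //.
  by case: ss.
rewrite -ge0_integralZl//; last exact/measurable_EFinP.
apply: ge0_le_integral => //.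
- apply: measurableT_comp => //; apply/measurable_EFinP/measurable_funB.
    by apply: measurable_fun_dot; case: ss.
  exact: measurable_fun_dot.
- apply/measurable_EFinP; exact: measurable_funM.
- move=> x _; rewrite /= lee_fin -linearBl/= mulrC distrC.
  exact: (dot_le norm_dot).
Qed.

Lemma dot_is_bochner_integral f v u : is_bochner_integral mu f v ->
    mu.-integrable [set: T] (fun x => `|f x|%:E) ->
  dot v u = \int[mu]_x dot (f x) u.
Proof.
move=> [mf [s [ss fs Is]]] fi.
have Isu : dot (simple_integral mu (s n)) u @[n --> \oo] --> dot v u.
  exact: (cvg_comp _ _ Is (@continuous_dot _ _ _ norm_dot u v)).
suff Isf : dot (simple_integral mu (s n)) u @[n --> \oo]
    --> \int[mu]_x dot (f x) u by exact: cvg_unique Isu Isf.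
apply/cvgrPdist_le.
suff : (`|dot (simple_integral mu (s n)) u - \int[mu]_x dot (f x) u|%:E)
    @[n --> \oo] --> 0%E.
  move=> /fine_cvgP[_ /cvgrPdist_le] h e e0; apply: filterS (h e e0) => n /=.
  by rewrite sub0r normrN normr_id distrC.
apply: (@squeeze_cvge _ _ _ _ (cst 0%E) _
  (fun n => `|u|%:E * \int[mu]_x `|f x - s n x|%:E)%E).
- apply: nearW => n; rewrite lee_fin normr_ge0/=.
  exact: simple_integral_error.
- exact: cvg_cst.
- rewrite -[X in _ --> X](mule0 `|u|%:E).
  by apply: cvgeZl.
Qed.

End bochner_theory.

(** * Existence of the Bochner integral *)

(** The sequence starts at 0 so that the nearest of its first terms to [x] is
never farther from [x] than [|x|]. *)
Lemma separable_dense_seq (R : realType) (H : completeNormedModType R) :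
  separable H -> exists e : nat -> H, e 0 = 0 /\
    forall (x : H) (eps : R), 0 < eps -> exists n, `|x - e n| < eps.
Proof.
move=> [D [/countable_injP[g ginj] denseD]].
exists (fun n => if n is m.+1 then
  if pselect (exists x, D x /\ g x = m) is left Dm then projT1 (cid Dm) else 0
  else 0).
split=> // x eps eps0.
have [|y [xy Dy]] := denseD (ball x eps) _ (ball_open x eps).
  by exists x; exact: ballxx.
exists (g y).+1; case: pselect => [Dm|]; last by case; exists y.
case: cid => z /= [Dz gzy].
suff -> : z = y by move: xy; rewrite -ball_normE.
by apply: ginj => //; exact/mem_set.
Qed.

Lemma label_dist_le (R : realType) (H : completeNormedModType R) k
    (c : 'I_k.+1 -> H) x j : `|x - c (label c x)| <= `|x - c j|.
Proof. by have /forallP := is_closest_label c x. Qed.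

Section bochner_existence.
Context d (T : measurableType d) (R : realType) (H : completeNormedModType R).
Implicit Types f : T -> H.

Lemma simple_nearest k (c : 'I_k.+1 -> H) f :
    measurable_fun [set: T] (f : T -> borel H) ->
  simple_vector_fun (fun x => c (label c (f x))).
Proof.
move=> mf; split; last first.
  apply: (@sub_finite_set _ _ (range c)); last exact: finite_image.
  by move=> _ [x _ <-]; exists (label c (f x)).
move=> _ A mA; rewrite setTI.
rewrite (_ : _ @^-1` A = \bigcup_(j in [set j | A (c j)]) (f @^-1` cell c j)).
  apply: fin_bigcup_measurable => // j _.
  rewrite -[X in measurable X]setTI.
  exact: (mf measurableT _ (measurable_cell c j)).
apply/seteqP; split => x /=.
  by move=> Ax; exists (label c (f x)).
by move=> [j /= Aj]; rewrite /cell/= => ->.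
Qed.

(** Projecting [f] onto the nearest of the first [n] terms of a dense sequence
converges pointwise by density, and the error is dominated by [|f|] because 0
is one of the terms. *)
Lemma nearest_L1 (mu : {finite_measure set T -> \bar R}) f (e : nat -> H) :
    measurable_fun [set: T] (f : T -> borel H) ->
    mu.-integrable [set: T] (fun x => `|f x|%:E) ->
    e 0 = 0 ->
    (forall (x : H) (eps : R), 0 < eps -> exists n, `|x - e n| < eps) ->
  (\int[mu]_x `|f x - e (label (fun i : 'I_n.+1 => e i) (f x))|%:E)%E
    @[n --> \oo] --> 0%E.
Proof.
move=> mf fi e0 edense.
pose g n x := `|f x - e (label (fun i : 'I_n.+1 => e i) (f x))|%:E.
have mg n : measurable_fun [set: T] (g n).
  apply/measurable_EFinP; apply: measurable_fun_dist_simple => //.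
  exact: (simple_nearest (fun i : 'I_n.+1 => e i)).
have g_cvg x : g n x @[n --> \oo] --> 0%E.
  apply/fine_cvgP; split; first by apply: nearW => n.
  apply/cvgrPdist_lt => eps eps0.
  have [m xm] := edense (f x) eps eps0; exists m => // n /= mn.
  rewrite sub0r normrN normr_id; apply: le_lt_trans xm.
  have mn' : (m < n.+1)%N by [].
  exact: (label_dist_le (fun i : 'I_n.+1 => e i) (f x) (Ordinal mn')).
have g_dom n x : (`|g n x| <= `|f x|%:E)%E.
  have := label_dist_le (fun i : 'I_n.+1 => e i) (f x) ord0.
  by rewrite gee0_abs ?lee_fin//= e0 subr0.
have [_ _] := dominated_convergence measurableT mg (measurable_cst 0%E)
  (aeW _ (fun x _ => g_cvg x)) fi (aeW _ (fun x n _ => g_dom n x)).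
by rewrite integral0.
Qed.

Variable dot : {dot H for idfun}.
Hypothesis norm_dot : forall x : H, `|x| ^+ 2 = dot x x.

(** Test the difference of the two integrals against itself. *)
Lemma simple_integral_dist (mu : {finite_measure set T -> \bar R}) f s1 s2 :
    measurable_fun [set: T] (f : T -> borel H) ->
    mu.-integrable [set: T] (fun x => `|f x|%:E) ->
    simple_vector_fun s1 -> simple_vector_fun s2 ->
  (`|simple_integral mu s1 - simple_integral mu s2|%:E <=
    \int[mu]_x `|f x - s1 x|%:E + \int[mu]_x `|f x - s2 x|%:E)%E.
Proof.
move=> mf fi ss1 ss2; set u := _ - _.
have [->|u0] := eqVneq u 0.
  rewrite normr0; apply: adde_ge0;
    by apply: integral_ge0 => x _; rewrite lee_fin.
rewrite -(@lee_pmul2l _ `|u|%:E)//; last by rewrite lte_fin normr_gt0.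
rewrite ge0_muleDr; [|by apply: integral_ge0 => x _; rewrite lee_fin ..].
apply: le_trans (leeD (simple_integral_error norm_dot u mf ss1 fi)
  (simple_integral_error norm_dot u mf ss2 fi)).
rewrite -EFinM -EFinD lee_fin -expr2 norm_dot.
rewrite {1}/u linearBl/=; set a := dot _ u; set b := dot _ u.
set m := Rintegral _ _ _.
have := ler_norm (a - m); have := ler_norm (- (b - m)); rewrite normrN.
lra.
Qed.

Lemma bochner_integral_exists (mu : {finite_measure set T -> \bar R}) f :
    separable H -> measurable_fun [set: T] (f : T -> borel H) ->
    mu.-integrable [set: T] (fun x => `|f x|%:E) ->
  exists v, is_bochner_integral mu f v.
Proof.
move=> /separable_dense_seq[e [e0 edense]] mf fi.
pose s n x := e (label (fun i : 'I_n.+1 => e i) (f x)).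
have ss n : simple_vector_fun (s n).
  exact: (simple_nearest (fun i : 'I_n.+1 => e i)).
have fs := nearest_L1 mf fi e0 edense.
suff : cvgn (fun n => simple_integral mu (s n)).
  by move=> /cvg_ex[v Isv]; exists v; split => //; exists s.
apply: cauchy_cvg; apply: cauchy_exP => eps eps0.
have /fine_cvgP[fin /cvgrPdist_lt/(_ (eps / 2))] := fs.
rewrite divr_gt0// => /(_ isT) small.
have [N _ Nsmall] := filterI fin small.
exists (simple_integral mu (s N)); exists N => // n /= Nn.
rewrite -ball_normE /ball_/= -lte_fin.
apply: (le_lt_trans (simple_integral_dist mf fi (ss N) (ss n))).
have [finN ltN] := Nsmall N (leqnn N); have [finn ltn] := Nsmall n Nn.
have half m : (\int[mu]_x `|f x - s m x|%:E)%E \is a fin_num ->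
    `|0 - fine (\int[mu]_x `|f x - s m x|%:E)%E| < eps / 2 ->
    (\int[mu]_x `|f x - s m x|%:E < (eps / 2)%:E)%E.
  move=> finm; rewrite sub0r normrN => /(le_lt_trans (ler_norm _)).
  by rewrite -lte_fin fineK.
rewrite [eps]splitr EFinD; apply: lteD; exact: half.
Qed.

Lemma dot_bochner_integral (mu : {finite_measure set T -> \bar R}) f u :
    separable H -> measurable_fun [set: T] (f : T -> borel H) ->
    mu.-integrable [set: T] (fun x => `|f x|%:E) ->
  dot (bochner_integral mu f) u = \int[mu]_x dot (f x) u.
Proof.
move=> Hsep mf fi; apply: (dot_is_bochner_integral norm_dot) => //.
apply: getPex; exact: bochner_integral_exists.
Qed.

End bochner_existence.

(** * The two criteria in terms of the normalizing constant *)

Section criteria_theory.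
Context (R : realType) (H : completeNormedModType R) (k : nat).
Variables (P : probability (borel H) R) (sigma : R).
Hypothesis sigma_gt0 : 0 < sigma.
Implicit Types c : 'I_k.+1 -> H.

Lemma temperature_gt0 : 0 < 2 * sigma ^+ 2.
Proof. by rewrite mulr_gt0// exprn_gt0. Qed.

Lemma distortion_ge0 c x : 0 <= distortion c x.
Proof. by rewrite /distortion exprn_ge0. Qed.

Lemma distortion_le c x j : distortion c x <= `|x - c j| ^+ 2.
Proof. by rewrite lerXn2r ?nnegrE//; exact: label_dist_le. Qed.

Lemma min_sqdistE c x : min_sqdist c x = distortion c x.
Proof.
apply/eqP; rewrite eq_le; apply/andP; split.
  exact: (bigmin_le _ (label c x) (fun j => `|x - c j| ^+ 2)).
by apply/bigmin_geP; split => [|j _]; exact: distortion_le.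
Qed.

Lemma measurable_distortion c :
  measurable_fun [set: borel H] (distortion c : borel H -> R).
Proof. by apply: measurable_funX; exact: measurable_label_dist. Qed.

Lemma R2E c : R2 P sigma c =
  ((2 * sigma ^+ 2) * (1 - gibbs_constant P sigma c))%:E.
Proof.
rewrite /R2 [RHS]EFinM; congr (_ * _)%E.
have iw := integrable_gibbs_weight P sigma c.
under eq_integral do rewrite min_sqdistE EFinB.
rewrite integralB//=; last exact: finite_measure_integrable_cst.
rewrite -gibbs_constantE EFinB; congr (_ - _)%E.
exact: probability_integral_cst.
Qed.

(** This is [t exp (- t) <= 1]; it makes the distortion integrable under the
Gibbs law whatever the moments of [P]. *)
Lemma distortion_weight_le c x :
  distortion c x * gibbs_weight sigma c x <= 2 * sigma ^+ 2.
Proof.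
have T0 := temperature_gt0.
rewrite -[leRHS]mulr1 -ler_pdivrMl// mulrA /gibbs_weight mulNr.
set t := _^-1 * _; rewrite expRN ler_pdivrMr ?expR_gt0// mul1r.
by rewrite (le_trans _ (expR_ge1Dx t))// lerDr.
Qed.

Definition gibbs_density c x :=
  (gibbs_constant P sigma c)^-1 * gibbs_weight sigma c x.

Lemma gibbs_density_gt0 c x : 0 < gibbs_density c x.
Proof. by rewrite mulr_gt0 ?expR_gt0// invr_gt0 gibbs_constant_gt0. Qed.

Lemma gibbs_density_ge0 c x : 0 <= gibbs_density c x.
Proof. exact/ltW/gibbs_density_gt0. Qed.

Lemma measurable_gibbs_density c :
  measurable_fun [set: borel H] (gibbs_density c : borel H -> R).
Proof. by apply: measurable_funM => //; exact: measurable_gibbs_weight. Qed.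

Lemma gibbsE c A : measurable A ->
  gibbs P sigma c A = (\int[P]_(x in A) (gibbs_density c x)%:E)%E.
Proof. by []. Qed.

Lemma ln_gibbs_density c x : ln (gibbs_density c x) =
  - (2 * sigma ^+ 2)^-1 * distortion c x - ln (gibbs_constant P sigma c).
Proof.
rewrite lnM ?posrE ?expR_gt0 ?invr_gt0 ?gibbs_constant_gt0//.
by rewrite lnV ?posrE ?gibbs_constant_gt0// expRK addrC.
Qed.

Lemma integrable_ln_gibbs_density (Q : probability (borel H) R) c :
    Q.-integrable [set: borel H] (fun x => (distortion c x)%:E) ->
  Q.-integrable [set: borel H] (fun x => (ln (gibbs_density c x))%:E).
Proof.
move=> di; under eq_fun do rewrite ln_gibbs_density EFinB EFinM.
apply: integrableB => //; first exact: integrableZl.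
exact: finite_measure_integrable_cst.
Qed.

Lemma integral_ln_gibbs_density (Q : probability (borel H) R) c :
    Q.-integrable [set: borel H] (fun x => (distortion c x)%:E) ->
  (\int[Q]_x (ln (gibbs_density c x))%:E =
   (- (2 * sigma ^+ 2)^-1 * \int[Q]_x (distortion c x) -
     ln (gibbs_constant P sigma c))%:E)%E.
Proof.
move=> di; under eq_integral do rewrite ln_gibbs_density EFinB EFinM.
rewrite integralB//=; last 2 first.
- exact: integrableZl.
- exact: finite_measure_integrable_cst.
rewrite integralZl// EFinB EFinM fineK; last exact: integrable_fin_num.
by congr (_ - _)%E; exact: probability_integral_cst.
Qed.

Lemma free_energy_gibbs_density (Q : probability (borel H) R) c :
    Q.-integrable [set: borel H] (fun x => (distortion c x)%:E) ->
  ((2 * sigma ^+ 2)%:E * (\int[Q]_x (ln (gibbs_density c x))%:E) =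
   (- (2 * sigma ^+ 2) * ln (gibbs_constant P sigma c))%:E -
     \int[Q]_x (distortion c x)%:E)%E.
Proof.
move=> di; rewrite integral_ln_gibbs_density//.
rewrite -[in RHS](fineK (integrable_fin_num _ di))// -EFinM -EFinB.
congr EFin; rewrite mulrBr mulNr mulrN mulrA mulfV ?gt_eqF ?temperature_gt0//.
by rewrite mul1r addrC mulNr.
Qed.

Lemma kullback_ge0 (Q : probability (borel H) R) : (0 <= kullback Q P)%E.
Proof.
have := @kullback_ge _ _ _ Q P (cst 1) (measurable_cst _) (fun=> ltr01).
rewrite /= ln1 integral0; apply.
  by rewrite probability_integral_cst.
exact: (finite_measure_integrable_cst Q 0 measurableT).
Qed.

(** When [Q] has infinite distortion, nonnegativity of the divergence is needed
to keep the sum from being an indeterminate form; otherwise the logarithm of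
the Gibbs density is [Q]-integrable and [kullback_ge] applies to it. *)
Lemma C2_ge c :
  ((- (2 * sigma ^+ 2) * ln (gibbs_constant P sigma c))%:E <= C2 P sigma c)%E.
Proof.
have T0 := temperature_gt0.
apply: le_ereal_inf_tmp => _ [Q _ <-].
have d0 : (0 <= \int[Q]_x (distortion c x)%:E)%E.
  by apply: integral_ge0 => x _; rewrite lee_fin distortion_ge0.
have [dy|dy] := eqVneq (\int[Q]_x (distortion c x)%:E)%E +oo%E.
  rewrite dy addey ?leey// gt_eqF// (lt_le_trans ltNy0)//.
  by rewrite mule_ge0 ?kullback_ge0// lee_fin ltW.
have di : Q.-integrable [set: borel H] (fun x => (distortion c x)%:E).
  apply/integrableP; split.
    by apply/measurable_EFinP; exact: measurable_distortion.
  under eq_integral do rewrite /= ger0_norm ?distortion_ge0//.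
  by rewrite ltey.
rewrite -leeBlDr; last exact: integrable_fin_num.
rewrite -free_energy_gibbs_density// lee_pmul2l// ?lte_fin//.
apply: kullback_ge => //.
- exact: measurable_gibbs_density.
- exact: gibbs_density_gt0.
- rewrite -(gibbsE c measurableT) le_eqVlt.
  by rewrite [X in X == _](probability_setT (gibbs P sigma c)) eqxx.
- exact: integrable_ln_gibbs_density.
Qed.

Lemma integrable_gibbs c (f : borel H -> R) : measurable_fun [set: borel H] f ->
    P.-integrable [set: borel H] (fun x => (f x * gibbs_weight sigma c x)%:E) ->
  (gibbs P sigma c).-integrable [set: borel H] (fun x => (f x)%:E).
Proof.
move=> mf fwi; apply: (@integrable_density _ _ _ (gibbs P sigma c) P
  (gibbs_density c)) => //.
- exact: measurable_gibbs_density.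
- exact: gibbs_density_ge0.
- have := integrableZl measurableT (gibbs_constant P sigma c)^-1 fwi.
  by apply: eq_integrable => // x _; rewrite -EFinM mulrCA.
Qed.

Lemma integrable_bounded (mu : {finite_measure set (borel H) -> \bar R})
    (f : borel H -> R) (M : R) : measurable_fun [set: borel H] f ->
    (forall x, `|f x| <= M) ->
  mu.-integrable [set: borel H] (fun x => (f x)%:E).
Proof.
move=> mf fM.
apply: le_integrable (finite_measure_integrable_cst mu M measurableT) => //.
  exact/measurable_EFinP.
by move=> x _; rewrite lee_fin (le_trans (fM x))// ler_norm.
Qed.

Lemma integrable_distortion_gibbs c :
  (gibbs P sigma c).-integrable [set: borel H] (fun x => (distortion c x)%:E).
Proof.
apply: integrable_gibbs; first exact: measurable_distortion.
apply: (integrable_bounded _ (M := 2 * sigma ^+ 2)) => [|x].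
  apply: measurable_funM; first exact: measurable_distortion.
  exact: measurable_gibbs_weight.
by rewrite ger0_norm ?distortion_weight_le// mulr_ge0 ?expR_ge0 ?distortion_ge0.
Qed.

(** The Gibbs law of [c] is used as a competitor for [c']. *)
Lemma C2_le c c' :
  (C2 P sigma c' <= (- (2 * sigma ^+ 2) * ln (gibbs_constant P sigma c))%:E
    - \int[gibbs P sigma c]_x (distortion c x)%:E
    + \int[gibbs P sigma c]_x (distortion c' x)%:E)%E.
Proof.
apply: ereal_inf_lbound; exists (gibbs P sigma c) => //; congr (_ + _)%E.
rewrite -free_energy_gibbs_density; last exact: integrable_distortion_gibbs.
congr (_ * _)%E; apply: kullback_density.
- exact: measurable_gibbs_density.
- exact: gibbs_density_gt0.
- exact: gibbsE.
Qed.

Lemma C2E c :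
  C2 P sigma c = (- (2 * sigma ^+ 2) * ln (gibbs_constant P sigma c))%:E.
Proof.
apply/eqP; rewrite eq_le C2_ge andbT (le_trans (C2_le c c))//.
by rewrite subeK// integrable_fin_num// integrable_distortion_gibbs.
Qed.

Lemma R2_le c c' : (C2 P sigma c' <= C2 P sigma c)%E ->
  (R2 P sigma c' <= R2 P sigma c)%E.
Proof.
have T0 := temperature_gt0.
rewrite !C2E !R2E !lee_fin !mulNr lerN2 !ler_pM2l//.
by rewrite ler_ln ?posrE ?gibbs_constant_gt0//; lra.
Qed.

End criteria_theory.

(** * Conditional laws and decomposition along the cells *)

Section conditional_theory.
Context d (T : measurableType d) (R : realType).
Variables (P : probability T R) (D : set T) (mD : measurable D).
Hypothesis PD0 : P D <> 0%E.

Let PDfin : P D \is a fin_num. Proof. exact: fin_num_measure. Qed.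

Let phi x : R := (fine (P D))^-1 * \1_D x.

Let mphi : measurable_fun [set: T] phi.
Proof. by apply: measurable_funM => //; exact: measurable_indic. Qed.

Let phi_ge0 x : 0 <= phi x.
Proof. by rewrite mulr_ge0// invr_ge0 fine_ge0. Qed.

Let conditionalE A : measurable A ->
  conditional P mD A = (\int[P]_(x in A) (phi x)%:E)%E.
Proof.
move=> mA; under eq_integral do rewrite EFinM.
rewrite integralZl//; last first.
  by apply: (integrableS measurableT) => //; exact: integrable_indic.
have DT : (mrestr P mD : {measure set T -> \bar R}) [set: T] = P D.
  by rewrite /= /mrestr setTI.
rewrite integral_indic//.
transitivity (mnormalize (mrestr P mD) P A); first by [].
rewrite /mnormalize DT ifF; first by rewrite muleC setIC.
apply/negbTE; rewrite negb_or; apply/andP; split; first exact/eqP.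
by rewrite -ltey ltey_eq PDfin.
Qed.

Lemma integrable_conditional (f : T -> R) :
    P.-integrable [set: T] (fun x => (f x)%:E) ->
  (conditional P mD).-integrable [set: T] (fun x => (f x)%:E).
Proof.
move=> fi.
have mf : measurable_fun [set: T] f.
  by apply/measurable_EFinP; exact: measurable_int fi.
apply: (integrable_density mphi phi_ge0 conditionalE mf).
have := integrableZl measurableT (fine (P D))^-1 fi.
apply: le_integrable => //.
  by apply/measurable_EFinP; exact: measurable_funM.
move=> x _; rewrite -EFinM lee_fin !normrM mulrCA mulrA -[leRHS]mulr1.
rewrite ler_wpM2l ?mulr_ge0//.
by rewrite indicE; case: (_ \in _); rewrite ?normr1 ?normr0.
Qed.

Lemma Rintegral_indic (mu : {measure set T -> \bar R}) (f : T -> R) :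
  \int[mu]_x (f x * \1_D x) = \int[mu]_(x in D) f x.
Proof.
rewrite [RHS]Rintegral_mkcond; apply: eq_Rintegral => x _.
by rewrite /patch indicE; case: ifP => _; rewrite ?mulr1 ?mulr0.
Qed.

Lemma Rintegral_conditional (f : T -> R) :
    P.-integrable [set: T] (fun x => (f x)%:E) ->
  \int[conditional P mD]_x f x =
  (fine (P D))^-1 * \int[P]_(x in D) f x.
Proof.
move=> fi.
have mf : measurable_fun [set: T] f.
  by apply/measurable_EFinP; exact: measurable_int fi.
rewrite (Rintegral_density mphi phi_ge0 conditionalE mf).
have fDi : P.-integrable D (EFin \o f).
  exact: (integrableS measurableT).
rewrite -RintegralZl// -[RHS]Rintegral_indic.
by apply: eq_Rintegral => x _; rewrite /phi; lra.
Qed.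

End conditional_theory.

Section cells.
Context (R : realType) (H : completeNormedModType R) (k : nat).
Variable (c : 'I_k.+1 -> H).
Variable mu : {finite_measure set (borel H) -> \bar R}.

Lemma label_sum (F : 'I_k.+1 -> R) x :
  F (label c x) = \sum_j F j * \1_(cell c j) x.
Proof.
rewrite (bigD1 (label c x))//= big1 => [|j jx].
  by rewrite indicE mem_set// mulr1 addr0.
by rewrite indicE memNset ?mulr0//= => /esym/eqP; exact/negP.
Qed.

Lemma integrable_cell (f : borel H -> R) j :
    mu.-integrable [set: borel H] (fun x => (f x)%:E) ->
  mu.-integrable [set: borel H] (fun x => (f x * \1_(cell c j) x)%:E).
Proof.
move=> fi; have mf : measurable_fun [set: borel H] f.
  by apply/measurable_EFinP; exact: measurable_int fi.
apply: le_integrable fi => //.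
  apply/measurable_EFinP; apply: measurable_funM => //.
  by apply: measurable_indic; exact: measurable_cell.
move=> x _; rewrite lee_fin normrM -[leRHS]mulr1 ler_wpM2l//.
by rewrite indicE; case: (_ \in _); rewrite ?normr1 ?normr0.
Qed.

Lemma integrable_label (F : 'I_k.+1 -> borel H -> R) :
    (forall j, mu.-integrable [set: borel H] (fun x => (F j x)%:E)) ->
  mu.-integrable [set: borel H] (fun x => (F (label c x) x)%:E).
Proof.
move=> Fi; under eq_fun do rewrite (label_sum (F ^~ _)) -sumEFin.
by apply: integrable_sum => // j _; exact: integrable_cell.
Qed.

Lemma Rintegral_label (F : 'I_k.+1 -> borel H -> R) :
    (forall j, mu.-integrable [set: borel H] (fun x => (F j x)%:E)) ->
  \int[mu]_x F (label c x) x = \sum_j \int[mu]_(x in cell c j) F j x.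
Proof.
move=> Fi; rewrite /Rintegral.
under eq_integral do rewrite (label_sum (F ^~ _)) -sumEFin.
rewrite integral_sum//; last by move=> j; exact: integrable_cell.
rewrite -sum_fine; last first.
  by move=> j _; apply: integrable_fin_num => //; exact: integrable_cell.
by apply: eq_bigr => j _; exact: Rintegral_indic.
Qed.

End cells.

(** * The updated centers *)

Section update.
Context (R : realType) (H : completeNormedModType R) (dot : {dot H for idfun}).
Hypothesis norm_dot : forall x : H, `|x| ^+ 2 = dot x x.
Hypothesis H_separable : separable H.
Context (k : nat) (P : probability (borel H) R) (sigma : R).
Hypothesis sigma_gt0 : 0 < sigma.
Variable c : 'I_k.+1 -> H.

Local Notation w := (gibbs_weight sigma c).
Local Notation G := (gibbs P sigma c).
Local Notation Z := (gibbs_constant P sigma c).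

Let norm_le x : `|x| <= distortion c x + (1 + \sum_j `|c j|).
Proof.
have cle : `|c (label c x)| <= \sum_j `|c j|.
  by rewrite (bigD1 (label c x))//= lerDl sumr_ge0.
have := ler_normD (x - c (label c x)) (c (label c x)); rewrite subrK.
rewrite /distortion; set t := `|x - _|.
have : 0 <= (t - 2^-1) ^+ 2 by rewrite sqr_ge0.
by rewrite sqrrB; lra.
Qed.

Let norm_borel : measurable_fun [set: borel H] (fun x : borel H => `|x : H|).
Proof. by apply: continuous_borel_realfun; exact: norm_continuous. Qed.

Lemma norm_weight_le x :
  `|x| * w x <= 2 * sigma ^+ 2 + (1 + \sum_j `|c j|).
Proof.
have w0 : 0 <= w x by exact: expR_ge0.
have w1 : w x <= 1 by exact: gibbs_weight_le1.
have C0 : 0 <= 1 + \sum_j `|c j| by rewrite addr_ge0// sumr_ge0.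
apply: le_trans (ler_wpM2r w0 (norm_le x)) _; rewrite mulrDl lerD//.
  exact: distortion_weight_le.
by rewrite -[leRHS]mulr1 ler_wpM2l.
Qed.

Lemma integrable_norm_weight :
  P.-integrable [set: borel H] (fun x => (`|x : H| * w x)%:E).
Proof.
apply: (integrable_bounded _ (M := 2 * sigma ^+ 2 + (1 + \sum_j `|c j|))).
  by apply: measurable_funM => //; exact: measurable_gibbs_weight.
by move=> x; rewrite ger0_norm ?norm_weight_le// mulr_ge0// expR_ge0.
Qed.

Lemma integrable_norm_gibbs :
  G.-integrable [set: borel H] (fun x => `|x : H|%:E).
Proof. by apply: integrable_gibbs => //; exact: integrable_norm_weight. Qed.

Lemma Rintegral_gibbs (D : set (borel H)) (f : borel H -> R) :
    measurable D -> measurable_fun [set: borel H] f ->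
    P.-integrable [set: borel H] (fun x => (f x * w x)%:E) ->
  \int[G]_(x in D) f x = Z^-1 * \int[P]_(x in D) (f x * w x).
Proof.
move=> mD mf fwi; rewrite -Rintegral_indic.
rewrite (Rintegral_density (measurable_gibbs_density P sigma c)
  (gibbs_density_ge0 P sigma c) (gibbsE P sigma c)); last first.
  by apply: measurable_funM => //; exact: measurable_indic.
rewrite -RintegralZl//; last exact: (integrableS measurableT).
rewrite -[RHS]Rintegral_indic; apply: eq_Rintegral => x _.
by rewrite /gibbs_density; lra.
Qed.

(** The Gibbs density is everywhere positive. *)
Lemma gibbs_eq0 (D : set (borel H)) : measurable D ->
  G D = 0%E <-> P D = 0%E.
Proof.
move=> mD.
have mgD : measurable_fun D (EFin \o (gibbs_density P sigma c : borel H -> R)).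
  apply/measurable_EFinP; apply: measurable_funTS.
  exact: measurable_gibbs_density.
split=> [GD0|PD0]; last by rewrite gibbsE//; exact: null_set_integral.
have /(ae_eq_integral_abs P mD mgD).1 [N [mN PN0 subN]] :
    (\int[P]_(x in D) `|(EFin \o gibbs_density P sigma c) x| = 0)%E.
  rewrite -[RHS]GD0; apply: eq_integral => x _.
  by rewrite /= ger0_norm// gibbs_density_ge0.
apply/eqP; rewrite eq_le measure_ge0 andbT -PN0 le_measure ?inE//.
move=> x Dx; apply: subN => /= /(_ Dx)[] /eqP; rewrite gt_eqF//.
exact: gibbs_density_gt0.
Qed.

Lemma dot_updated_center j u : P (cell c j) <> 0%E ->
  dot (updated_center P sigma c j) u =
  (fine (G (cell c j)))^-1 * \int[G]_(x in cell c j) dot x u.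
Proof.
move=> Pj0; have mj := measurable_cell c j.
have Gj0 : G (cell c j) <> 0%E by move=> /(gibbs_eq0 mj).
rewrite (dot_bochner_integral norm_dot)//; last first.
  exact/integrable_conditional/integrable_norm_gibbs.
rewrite Rintegral_conditional//.
exact: (integrable_dot norm_dot u _ integrable_norm_gibbs).
Qed.

Let integrable_dot_weight u :
  P.-integrable [set: borel H] (fun x => (dot (x : H) u * w x)%:E).
Proof.
have := integrableZr measurableT `|u| integrable_norm_weight.
apply: le_integrable => //.
  apply/measurable_EFinP; apply: measurable_funM.
    exact: (measurable_fun_dot norm_dot).
  exact: measurable_gibbs_weight.
move=> x _; rewrite /= lee_fin normrM [leRHS]ger0_norm; last first.
  by rewrite !mulr_ge0 ?expR_ge0.
rewrite (ger0_norm (expR_ge0 _)) mulrAC ler_wpM2r ?expR_ge0//.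
exact: (dot_le norm_dot).
Qed.

(** On the cell [j] the weight centered at [c j] is the Gibbs weight, and off the
cell it is at most that weight, whence the integrability of its product with
the norm. *)
Lemma dot_weighted_center j u : P (cell c j) <> 0%E ->
  dot (weighted_center P sigma c j) u =
  (\int[P]_(x in cell c j) w x)^-1 * \int[P]_(x in cell c j) (dot x u * w x).
Proof.
move=> Pj0; have mj := measurable_cell c j.
pose wj (x : H) := expR (- (2 * sigma ^+ 2)^-1 * `|x - c j| ^+ 2).
have wjE x : cell c j x -> wj x = w x.
  by rewrite /cell/= /wj /gibbs_weight /distortion => ->.
have wj_le x : wj x <= w x.
  rewrite ler_expR !mulNr lerN2 ler_wpM2l ?distortion_le//.
  by rewrite invr_ge0 ltW// temperature_gt0.
have wj0 x : 0 <= wj x by exact: expR_ge0.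
have cont_wj : continuous wj.
  move=> x; apply: (@continuous_comp _ _ _
    (fun x : H => - (2 * sigma ^+ 2)^-1 * `|x - c j| ^+ 2) expR x).
    apply: cvgM; first exact: cvg_cst.
    apply: (@continuous_comp _ _ _ (fun x : H => `|x - c j|) (fun r => r ^+ 2)).
      exact: continuous_dist.
    exact: exprn_continuous.
  exact: continuous_expR.
have mwj : measurable_fun [set: borel H] (wj : borel H -> R).
  exact: continuous_borel_realfun.
have mwjx : measurable_fun [set: borel H]
    ((fun x : H => wj x *: x) : borel H -> borel H).
  apply: continuous_borel_fun => x.
  by apply: cvgZ; [exact: cont_wj|exact: cvg_id].
have iwj : P.-integrable [set: borel H] (fun x => (wj x)%:E).
  apply: (integrable_bounded _ (M := 1)) => // x.
  by rewrite ger0_norm// (le_trans (wj_le x))// gibbs_weight_le1.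
have inwj : P.-integrable [set: borel H] (fun x => `|wj x *: (x : H)|%:E).
  apply: le_integrable integrable_norm_weight => //.
    apply/measurable_EFinP.
    under eq_fun do rewrite normrZ.
    by apply: measurable_funM => //; exact: measurableT_comp.
  move=> x _; rewrite lee_fin normr_id normrZ mulrC ger0_norm//.
  by rewrite [leRHS]ger0_norm ?mulr_ge0 ?expR_ge0// ler_wpM2l.
have PDu0 : fine (P (cell c j)) != 0.
  by rewrite fine_eq0 ?fin_num_measure//; exact/eqP.
rewrite /weighted_center linearZl_LR/=.
rewrite (dot_bochner_integral norm_dot)//; last first.
  exact: integrable_conditional.
rewrite !Rintegral_conditional//; last exact: (integrable_dot norm_dot).
rewrite invfM invrK mulrACA mulfV// mul1r.
congr (_^-1 * _); apply: eq_Rintegral => x; rewrite inE => xj.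
  exact: wjE.
by rewrite linearZl_LR/= -/(wj x) wjE// mulrC.
Qed.

Lemma updated_center_weighted j : P (cell c j) <> 0%E ->
  updated_center P sigma c j = weighted_center P sigma c j.
Proof.
move=> Pj0; have mj := measurable_cell c j.
apply: (dot_inj norm_dot) => u.
rewrite dot_updated_center// dot_weighted_center//.
rewrite Rintegral_gibbs//; last exact: (measurable_fun_dot norm_dot).
have -> : fine (G (cell c j)) = Z^-1 * \int[P]_(x in cell c j) w x.
  rewrite -RintegralZl//.
  by apply: (integrableS measurableT) => //; exact: integrable_gibbs_weight.
by rewrite invfM invrK mulrACA mulfV ?mul1r// gt_eqF// gibbs_constant_gt0.
Qed.

Variable c' : 'I_k.+1 -> H.
Hypothesis c'E :
  forall j, P (cell c j) <> 0%E -> c' j = updated_center P sigma c j.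

Let integrable_cross j : G.-integrable [set: borel H]
  (fun x => (dot ((x : H) - c' j) (c' j - c j))%:E).
Proof.
have i1 := integrable_dot norm_dot (c' j - c j)
  (@measurable_id _ _ _) integrable_norm_gibbs.
have i2 := finite_measure_integrable_cst G (dot (c' j) (c' j - c j))
  measurableT.
apply: eq_integrable (integrableB measurableT i1 i2) => // x _.
by rewrite /= linearBl.
Qed.

(** [c' j] is the [G]-mean of the cell [j]; a cell that is null for [P], where
[c' j] is arbitrary, is also null for [G]. *)
Lemma integral_cell_updated_center j u :
  \int[G]_(x in cell c j) dot (x - c' j) u = 0.
Proof.
have mj := measurable_cell c j.
have i1 := integrable_dot norm_dot u (@measurable_id _ _ _)
  integrable_norm_gibbs.
have i2 := finite_measure_integrable_cst G (dot (c' j) u) measurableT.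
have [Pj0|/eqP Pj0] := eqVneq (P (cell c j)) 0%E.
  rewrite /Rintegral null_set_integral//; last by apply/gibbs_eq0.
  apply/measurable_EFinP/measurable_funTS.
  under eq_fun do rewrite linearBl/=.
  by apply: measurable_funB => //; exact: (measurable_fun_dot norm_dot).
under eq_Rintegral do rewrite linearBl/=.
rewrite RintegralB//; last 2 first.
- exact: (integrableS measurableT).
- exact: (integrableS measurableT).
rewrite Rintegral_cst// c'E// dot_updated_center//.
have Gj0 : fine (G (cell c j)) != 0.
  rewrite fine_eq0; last exact: fin_num_measure.
  by apply/eqP => /(gibbs_eq0 mj).
by rewrite mulrAC mulVf// mul1r subrr.
Qed.

(** Pythagoras: [|x - c'_l|^2 = d_c - |c_l - c'_l|^2 - 2 h] pointwise, where the
cross term [h] has zero integral on each cell. *)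
Lemma distortion_updated_center :
  (\int[G]_x (distortion c' x)%:E <= \int[G]_x (distortion c x)%:E -
    \int[G]_x (`|c (label c x) - c' (label c x)| ^+ 2)%:E)%E.
Proof.
pose hj j (x : H) := dot (x - c' j) (c' j - c j).
pose h x := hj (label c x) x.
pose e x := `|c (label c x) - c' (label c x)| ^+ 2.
have hi : G.-integrable [set: borel H] (fun x => (h x)%:E).
  exact: (integrable_label c (F := hj)).
have h0 : (\int[G]_x (h x)%:E = 0)%E.
  rewrite -(fineK (integrable_fin_num _ hi))//; congr EFin.
  rewrite -/(Rintegral _ _ _).
  rewrite (Rintegral_label c (F := hj))//.
  by rewrite big1// => j _; exact: integral_cell_updated_center.
have ei : G.-integrable [set: borel H] (fun x => (e x)%:E).
  apply: (integrable_label c (F := fun j _ => `|c j - c' j| ^+ 2)) => j.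
  exact: finite_measure_integrable_cst.
have di := integrable_distortion_gibbs P sigma_gt0 c.
have h2i := integrableZl measurableT 2 hi.
have dei := integrableB measurableT di ei.
have -> : (\int[G]_x (distortion c x)%:E - \int[G]_x (e x)%:E =
  \int[G]_x (distortion c x - e x - 2 * h x)%:E)%E.
  under [RHS]eq_integral do rewrite 2!EFinB EFinM.
  rewrite (integralB measurableT dei h2i) (integralB measurableT di ei).
  by rewrite (integralZl measurableT hi) h0 mule0 sube0.
apply: ge0_le_integral => //.
- by move=> x _; rewrite lee_fin distortion_ge0.
- by apply/measurable_EFinP; exact: measurable_distortion.
- exact: measurable_int (integrableB measurableT dei h2i).
- move=> x _; rewrite lee_fin.
  apply: le_trans (distortion_le c' x (label c x)) _.
  have := sqr_normD norm_dot (x - c' (label c x))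
    (c' (label c x) - c (label c x)).
  rewrite addrA subrK -/(distortion c x) -/(hj _ _) -/(h x).
  rewrite (distrC (c' _)) -/(e x).
  by lra.
Qed.

Lemma C2_update : (C2 P sigma c' <= C2 P sigma c -
  \int[G]_x (`|c (label c x) - c' (label c x)| ^+ 2)%:E)%E.
Proof.
apply: (le_trans (C2_le P sigma_gt0 c c')).
rewrite C2E// -addeA leeD2l// addeC.
have di := integrable_fin_num measurableT
  (integrable_distortion_gibbs P sigma_gt0 c).
by rewrite leeBlDr// addeC; exact: distortion_updated_center.
Qed.

End update.

Theorem proposition5 (R : realType) (H : completeNormedModType R)
    (dot : {dot H for idfun})
    (norm_dot : forall x : H, `|x| ^+ 2 = dot x x)
    (H_separable : separable H)
    (P : probability (borel H) R)
    (sigma : R) (sigma_gt0 : 0 < sigma)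
    (k : nat) (c c' : 'I_k.+1 -> H)
    (c'E : forall j, P (cell c j) <> 0%E -> c' j = updated_center P sigma c j) :
  [/\ forall j, P (cell c j) <> 0%E ->
        updated_center P sigma c j = weighted_center P sigma c j,
      (C2 P sigma c' <= C2 P sigma c -
        \int[gibbs P sigma c]_x (`|c (label c x) - c' (label c x)| ^+ 2)%:E)%E,
      (C2 P sigma c -
        \int[gibbs P sigma c]_x (`|c (label c x) - c' (label c x)| ^+ 2)%:E
       <= C2 P sigma c)%E &
      (R2 P sigma c' <= R2 P sigma c)%E].
Proof.
have C2_decrease :=
  C2_update norm_dot H_separable sigma_gt0 c'E.
have drop_le : (C2 P sigma c -
    \int[gibbs P sigma c]_x (`|c (label c x) - c' (label c x)| ^+ 2)%:E
    <= C2 P sigma c)%E.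
  rewrite -[leRHS]adde0 leeD2l// oppe_le0.
  by apply: integral_ge0 => x _; rewrite lee_fin exprn_ge0.
split=> //.
- by move=> j; exact: updated_center_weighted.
- by apply: R2_le => //; exact: le_trans C2_decrease drop_le.
Qed.
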